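(* Let $0<\lambda<1$ and $c\in\mathbb{R}$, and let $K\subset\mathbb{R}$ be the self-similar set (attractor) of the iterated function system $$f_1(x)=\lambda x,\qquad f_2(x)=\lambda x+c-\lambda,\qquad f_3(x)=\lambda x+1-\lambda .$$ Assume that the convex hull of $K$ is $I=[0,1]$, that $f_1(I)\cap f_2(I)\neq\emptyset$, and that $(f_1(I)\cup f_2(I))\cap f_3(I)=\emptyset$. Then $$K\cdot K=[0,1]\quad\text{if and only if}\quad (1-\lambda)^2\leq c .$$
   Context: For $A,B\subset\mathbb{R}$, $A\cdot B=\{x\cdot y: x\in A,\ y\in B\}$. The attractor $K$ of the iterated function system $\{f_1,f_2,f_3\}$ is the unique non-empty compact set with $K=f_1(K)\cup f_2(K)\cup f_3(K)$. *)

(* Defs.v *)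
From mathcomp Require Import all_boot all_order all_algebra.
From mathcomp Require Import all_classical all_reals all_analysis.

Set Implicit Arguments.
Unset Strict Implicit.
Unset Printing Implicit Defensive.

Import Order.TTheory GRing.Theory Num.Theory.
Import numFieldNormedType.Exports.

Local Open Scope classical_set_scope.
Local Open Scope ring_scope.

(* Uniqueness of such a K is not part of the predicate: for contractions of a
   complete metric space it is Hutchinson's theorem. *)
Definition is_attractor (T : topologicalType) (f1 f2 f3 : T -> T)
    (K : set T) : Prop :=
  [/\ K !=set0, compact K & K = f1 @` K `|` f2 @` K `|` f3 @` K].

(* convex_set is stated for modules over R; R^o is R as a module over itself. *)
Definition convex_hull (R : realType) (A : set R) : set R :=
  smallest (@convex_set R R^o) A.

Definition mul_set (R : realType) (A B : set R) : set R :=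
  [set x * y | x in A & y in B].

Section ifs.
Context (R : realType).

Definition f1 (lambda : R) (x : R) : R := lambda * x.
Definition f2 (lambda c : R) (x : R) : R := lambda * x + c - lambda.
Definition f3 (lambda : R) (x : R) : R := lambda * x + 1 - lambda.

End ifs.

(* Main.v *)
Require Import Defs.
From mathcomp Require Import all_boot all_order all_algebra.
From mathcomp Require Import all_classical all_reals all_analysis.
From mathcomp Require Import ring lra.

Set Implicit Arguments.
Unset Strict Implicit.
Unset Printing Implicit Defensive.

Import Order.TTheory GRing.Theory Num.Theory.
Import numFieldNormedType.Exports.
Local Open Scope classical_set_scope.
Local Open Scope ring_scope.

(** Write I = [0,1]. The hypotheses amount to lambda <= c <= 2 lambda and c <
    1 - lambda, so that f1(I) and f2(I) together fill [0, c] and the first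
    approximation of K is the union of [0, c] and [1 - lambda, 1].

    Necessity: a product of two points of K is at most c, or at least (1 -
    lambda)^2 when both factors are at least 1 - lambda. If c < (1 -
    lambda)^2, the values strictly in between are missed.

    Sufficiency: call [a, a + t] a cylinder when a + t K is included in K; its
    children are the cylinders [a + t s, a + t s + t lambda] with s one of 0,
    c - lambda, 1 - lambda. When a and b are not too far apart compared with
    the gap r = 1 - lambda - c, namely (a + t) r <= b and (b + t) r <= a,
    every product of a point of [a, a + t] and a point of [b, b + t] is also
    such a product with each factor in a child ([mul_in_children]); this is
    where (1 - lambda)^2 <= c is used. The condition passes to the children,
    so one may iterate, and since the set of products of K is closed, all of
    [a, a + t][b, b + t] consists of products of points of K ([cylinder_mul]).
    Applied to f3(I) and f3(I), this gives [(1 - lambda)^2, 1]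
    ([mul_set_top]). Applied to f2(I) and f3(I), or when c < 1/2 to f2(f3(I))
    and the children of f3(I), it gives [lambda, c] ([mul_set_middle]).
    Together these cover [lambda, 1], and the rest of ]0, 1] follows by
    multiplying by powers of lambda, since lambda K is included in K. *)

(** * Preliminaries on real numbers *)

Lemma mul_itv_onto (R : realFieldType) (x x' y y' z : R) :
  0 <= x -> x <= x' -> 0 <= y -> y <= y' -> x * y <= z -> z <= x' * y' ->
  exists u v, [/\ z = u * v, x <= u <= x' & y <= v <= y'].
Proof.
move=> x0 xx' y0 yy' lez gez.
(* Keep the first factor at x as long as z <= x * y', then the second at y'. *)
have [zle|zgt] := leP z (x * y').
  have [x_eq0|x_neq0] := eqVneq x 0.
    exists x, y; split; rewrite ?lexx //.
    by move: lez zle; rewrite x_eq0 !mul0r => ? ?; lra.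
  have xp : 0 < x by rewrite lt_neqAle eq_sym x_neq0.
  exists x, (z / x); split; rewrite ?lexx //; first by field.
  by rewrite ler_pdivlMr // ler_pdivrMr // ![_ * x]mulrC lez zle.
have zp : 0 < z by apply: le_lt_trans zgt; rewrite mulr_ge0 //; lra.
have yp : 0 < y'.
  rewrite lt_neqAle (le_trans y0 yy') andbT eq_sym.
  by apply/eqP => y'0; move: gez; rewrite y'0 mulr0; lra.
exists (z / y'), y'; split; rewrite ?lexx ?andbT //.
  by field; apply: lt0r_neq0.
by rewrite ler_pdivlMr // ler_pdivrMr // gez (ltW zgt).
Qed.

Lemma exists_expr_lt (R : realType) (x e : R) :
  0 <= x -> x < 1 -> 0 < e -> exists n, x ^+ n < e.
Proof.
move=> x0 x1 e0.
have x1' : `|x| < 1 by rewrite ger0_norm.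
have [n _ /(_ n (leqnn n))] := cvgr0_norm_lt _ (cvg_geometric 1 x1') _ e0.
rewrite /geometric /= mul1r => xn_lt; exists n.
exact: le_lt_trans (ler_norm _) xn_lt.
Qed.

Lemma mul_set_closed (R : realType) (A B : set R) :
  compact A -> compact B -> closed (mul_set A B).
Proof.
move=> cA cB.
have -> : mul_set A B = (fun z : R * R => z.1 * z.2) @` (A `*` B).
  apply/seteqP; split=> z /=.
    by move=> [x Ax [y By <-]]; exists (x, y).
  by move=> [[x y] /= [Ax By] <-]; exists x => //; exists y.
apply: compact_closed; first exact: Rhausdorff.
apply: continuous_compact; last exact: compact_setX.
by apply: continuous_subspaceT => z; exact: mul_continuous.
Qed.

(** * Products of cylinders *)

(** The position of c relative to lambda that the geometric hypotheses express,
    together with the covering condition (1 - lambda)^2 <= c. *)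
Definition covering_parameters (R : realType) (lambda c : R) :=
  [/\ 0 < lambda, lambda <= c, c < 1 - lambda, c <= 2 * lambda
    & (1 - lambda) ^+ 2 <= c].

Section covering.
Context (R : realType) (lambda c : R).
Context (params : covering_parameters lambda c).

(** The translation parts of f1, f2, f3: each of these maps is
    x |-> s + lambda * x for a digit s. *)
Definition digit (s : R) := [\/ s = 0, s = c - lambda | s = 1 - lambda].

(** The point v lies in the union of the children of [a, a + t], written as two
    intervals since the first two children overlap and form [a, a + c t]. *)
Definition in_children (a t v : R) :=
  a <= v <= a + c * t \/ a + (1 - lambda) * t <= v <= a + t.

Lemma in_children_digit (a t v : R) : 0 <= t -> in_children a t v ->
  exists2 s, digit s & a + t * s <= v <= a + t * s + t * lambda.
Proof.
have [lambda_gt0 c_ge c_lt c_le sq_le_c] := params.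
move=> t0 [/andP[h1 h2]|/andP[h1 h2]].
  have [h|h] := leP v (a + t * lambda).
    by exists 0; [constructor 1|rewrite mulr0 addr0 h1 h].
  exists (c - lambda); first by constructor 2.
  have : 0 <= t * (2 * lambda - c) by apply: mulr_ge0; lra.
  by move=> ?; apply/andP; split; lra.
exists (1 - lambda); first by constructor 3.
by apply/andP; split; lra.
Qed.

(** The endpoints of [a, a + t] and [b, b + t] have ratios bounded by 1 / r,
    where r = 1 - lambda - c is the gap between the children of [0, 1].  This
    keeps the gap of one factor, magnified by the other one, small enough to be
    filled. *)
Definition balanced (a b t : R) :=
  (a + t) * (1 - lambda - c) <= b /\ (b + t) * (1 - lambda - c) <= a.

Lemma gap_le : 1 - lambda - c <= lambda * (1 - lambda).
Proof. by have [*] := params; lra. Qed.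

(** The children of [a, a + t] form a low and a high interval, and so do those
    of [b, b + t].  For b <= a the four products, in the order low-low,
    high-low, low-high, high-high (factor near a first), are intervals each of
    which starts before the preceding one ends.  The last of these overlaps is
    the one that requires (1 - lambda)^2 <= c. *)
Lemma mul_in_children_ordered (a b t u v : R) : 0 <= b -> b <= a -> 0 <= t ->
  (a + t) * (1 - lambda - c) <= b ->
  a <= u <= a + t -> b <= v <= b + t ->
  exists u' v', [/\ u * v = u' * v', in_children a t u' & in_children b t v'].
Proof.
have [lambda_gt0 c_ge c_lt c_le sq_le_c] := params.
move=> b0 ba t0 bal /andP[u1 u2] /andP[v1 v2].
set z := u * v.
have z1 : a * b <= z by apply: ler_pM => //; lra.
have z2 : z <= (a + t) * (b + t) by apply: ler_pM => //; lra.
have g := gap_le.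
have a0 : 0 <= a by lra.
have ct0 : 0 <= c * t by apply: mulr_ge0; lra.
have lt0' : 0 <= lambda * t by apply: mulr_ge0; lra.
have l1t0 : 0 <= (1 - lambda) * t by apply: mulr_ge0; lra.
have ctt : 0 <= (1 - c) * t by apply: mulr_ge0; lra.
have [h1|h1] := leP z ((a + c * t) * (b + c * t)).
  have [||||||u' [v' [-> ? ?]]] :=
    @mul_itv_onto _ a (a + c * t) b (b + c * t) z; try lra.
  by exists u', v'; split => //; left.
have [h2|h2] := leP z ((a + t) * (b + c * t)).
  have [||||||u' [v' [-> ? ?]]] :=
    @mul_itv_onto _ (a + (1 - lambda) * t) (a + t) b (b + c * t) z; try lra.
    apply: le_trans (ltW h1).
    have : 0 <= t * (a * c + b * (c - (1 - lambda)) + c * c * t).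
      apply: mulr_ge0 => //.
      have : 0 <= (a - b) * c by apply: mulr_ge0; lra.
      have : 0 <= b * (c * 2 - (1 - lambda)) by apply: mulr_ge0 => //; nra.
      have : 0 <= c * (c * t) by apply: mulr_ge0; lra.
      lra.
    lra.
  by exists u', v'; split => //; [right|left].
have [h3|h3] := leP z ((a + c * t) * (b + t)).
  have [||||||u' [v' [-> ? ?]]] :=
    @mul_itv_onto _ a (a + c * t) (b + (1 - lambda) * t) (b + t) z; try lra.
    apply: le_trans (ltW h2).
    have : 0 <= t * (b + c * t - a * (1 - lambda - c)).
      apply: mulr_ge0 => //.
      have : 0 <= t * (1 - lambda - c) by apply: mulr_ge0; lra.
      lra.
    lra.
  by exists u', v'; split => //; [left|right].
have [||||||u' [v' [-> ? ?]]] :=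
  @mul_itv_onto _ (a + (1 - lambda) * t) (a + t)
    (b + (1 - lambda) * t) (b + t) z; try lra.
  apply: le_trans (ltW h3).
  have : 0 <= t * (a * lambda - b * (1 - lambda - c)
                   + (c - (1 - lambda) ^+ 2) * t).
    apply: mulr_ge0 => //.
    have : 0 <= (a - b) * lambda by apply: mulr_ge0; lra.
    have : 0 <= b * (lambda - (1 - lambda - c)) by apply: mulr_ge0 => //; nra.
    have : 0 <= (c - (1 - lambda) ^+ 2) * t by apply: mulr_ge0; lra.
    lra.
  lra.
by exists u', v'; split => //; [right|right].
Qed.

Lemma mul_in_children (a b t u v : R) : 0 <= a -> 0 <= b -> 0 <= t ->
  balanced a b t -> a <= u <= a + t -> b <= v <= b + t ->
  exists u' v', [/\ u * v = u' * v', in_children a t u' & in_children b t v'].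
Proof.
move=> a0 b0 t0 [bal1 bal2] hu hv.
have [ba|ab] := leP b a; first exact: mul_in_children_ordered.
have [|u' [v' [e ? ?]]] :=
  @mul_in_children_ordered b a t v u a0 _ t0 bal2 hv hu.
  exact: ltW.
by exists v', u'; split=> //; rewrite mulrC e mulrC.
Qed.

(** Children lie inside their parents: left endpoints grow and right endpoints
    decrease, so the two inequalities are preserved. *)
Lemma balanced_child (a b t s s' : R) : 0 <= t -> digit s -> digit s' ->
  balanced a b t -> balanced (a + t * s) (b + t * s') (t * lambda).
Proof.
have [lambda_gt0 c_ge c_lt c_le sq_le_c] := params.
move=> t0 ds ds' [b1 b2].
have key w : digit w -> 0 <= t * w /\ 0 <= t * (1 - lambda - w).
  by move=> [->|->|->]; split; apply: mulr_ge0 => //; lra.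
have [k1 k2] := key _ ds; have [k3 k4] := key _ ds'.
have r0 : 0 <= 1 - lambda - c by lra.
have := mulr_ge0 k2 r0; have := mulr_ge0 k4 r0.
by move=> ? ?; split; lra.
Qed.

Context (K : set R).
Context (K_compact : compact K) (K0 : K 0)
  (K01 : forall x, K x -> 0 <= x <= 1)
  (K_digit : forall s x, digit s -> K x -> K (s + lambda * x)).

(** The interval [a, a + t] carries a copy a + t K of K inside K. *)
Definition cylinder (a t : R) := forall x, K x -> K (a + t * x).

Lemma cylinder_child a t s : cylinder a t -> digit s ->
  cylinder (a + t * s) (t * lambda).
Proof.
move=> cyl ds x Kx.
have -> : a + t * s + t * lambda * x = a + t * (s + lambda * x) by ring.
exact/cyl/K_digit.
Qed.

Lemma cylinder_digit s : digit s -> cylinder s lambda.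
Proof. by move=> ds x; exact: K_digit. Qed.

(** Descending n generations traps u * v between products of the endpoints of
    two cylinders of length t * lambda ^+ n, whose left endpoints are in K. *)
Lemma cylinder_mul_approx n (a b t u v : R) : 0 <= a -> 0 <= b -> 0 <= t ->
  balanced a b t -> cylinder a t -> cylinder b t ->
  a <= u <= a + t -> b <= v <= b + t ->
  exists x y, [/\ K x, K y &
    x * y <= u * v <= (x + t * lambda ^+ n) * (y + t * lambda ^+ n)].
Proof.
have [lambda_gt0 c_ge c_lt c_le sq_le_c] := params.
elim: n a b t u v => [|n IHn] a b t u v a0 b0 t0 bal cyla cylb hu hv.
  exists a, b; split; [by have := cyla _ K0; rewrite mulr0 addr0
                      |by have := cylb _ K0; rewrite mulr0 addr0|].
  move: hu hv => /andP[? ?] /andP[? ?].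
  by rewrite expr0 mulr1; apply/andP; split; apply: ler_pM => //; lra.
have [u' [v' [-> gu gv]]] := mul_in_children a0 b0 t0 bal hu hv.
have [s ds hs] := in_children_digit t0 gu.
have [s' ds' hs'] := in_children_digit t0 gv.
have digit_ge0 w : digit w -> 0 <= w by move=> [->|->|->]; lra.
have := IHn _ _ _ u' v' _ _ _ (balanced_child t0 ds ds' bal)
  (cylinder_child cyla ds) (cylinder_child cylb ds') hs hs'.
rewrite exprS mulrA; apply.
- exact: addr_ge0 a0 (mulr_ge0 t0 (digit_ge0 _ ds)).
- exact: addr_ge0 b0 (mulr_ge0 t0 (digit_ge0 _ ds')).
- by rewrite mulr_ge0 // ltW.
Qed.

Lemma cylinder_mul (a b t u v : R) : 0 <= a -> 0 <= b -> 0 <= t -> t <= 1 ->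
  balanced a b t -> cylinder a t -> cylinder b t ->
  a <= u <= a + t -> b <= v <= b + t -> mul_set K K (u * v).
Proof.
have [lambda_gt0 c_ge c_lt c_le sq_le_c] := params.
move=> a0 b0 t0 t1 bal cyla cylb hu hv.
apply: (mul_set_closed K_compact K_compact).
move=> B /nbhs_ballP[e /= e0 eB].
have [n hn] : exists n, lambda ^+ n < e / 3 by apply: exists_expr_lt; lra.
have [x [y [Kx Ky /andP[h1 h2]]]] :=
  cylinder_mul_approx n a0 b0 t0 bal cyla cylb hu hv.
exists (x * y); split; first by exists x => //; exists y.
apply: eB; rewrite /ball /= ger0_norm ?subr_ge0 //.
move: (K01 Kx) (K01 Ky) => /andP[x0 x1] /andP[y0 y1].
set d := t * lambda ^+ n in h2.
have ln0 : 0 <= lambda ^+ n by rewrite exprn_ge0 // ltW.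
have ln1 : lambda ^+ n <= 1 by rewrite exprn_ile1 //; lra.
have d0 : 0 <= d by rewrite mulr_ge0.
have dl : d <= lambda ^+ n by rewrite ler_piMl.
(* The error u * v - x * y is at most d * (x + y + d). *)
have : d * (x + y + d) <= d * 3 by apply: ler_wpM2l => //; lra.
lra.
Qed.

(** * Covering the unit interval *)

Lemma mul_set_top z : (1 - lambda) ^+ 2 <= z -> z <= 1 -> mul_set K K z.
Proof.
have [lambda_gt0 c_ge c_lt c_le sq_le_c] := params.
move=> z1 z2.
have [||||||u [v [-> hu hv]]] :=
  @mul_itv_onto _ (1 - lambda) 1 (1 - lambda) 1 z; try lra.
have g := gap_le.
have d3 : digit (1 - lambda) by constructor 3.
apply: (@cylinder_mul (1 - lambda) (1 - lambda) lambda); try lra.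
- have : lambda * (1 - lambda) <= 1 * (1 - lambda) by apply: ler_wpM2r; lra.
  by move=> ?; split; lra.
- exact: cylinder_digit.
- exact: cylinder_digit.
Qed.

Lemma mul_set_middle z : lambda <= z -> z <= c -> mul_set K K z.
Proof.
have [lambda_gt0 c_ge c_lt c_le sq_le_c] := params.
move=> z1 z2.
have g := gap_le.
have d2 : digit (c - lambda) by constructor 2.
have d3 : digit (1 - lambda) by constructor 3.
have gl : 1 - lambda - c <= lambda by nra.
(* For c >= 1/2 the gap is at most c - lambda, so f2(I) and f3(I) are balanced;
   for c < 1/2 one has to move away from c - lambda, which may be 0. *)
have [c_half|c_half] := leP (1 / 2) c.
  have [||||||u [v [-> hu hv]]] :=
    @mul_itv_onto _ (c - lambda) c (1 - lambda) 1 z; try lra.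
    have : 0 <= (2 * lambda - c) * (1 - lambda) by apply: mulr_ge0; lra.
    have : 0 <= lambda * lambda by apply: mulr_ge0; lra.
    lra.
  have cr : c * (1 - lambda - c) <= 1 * (1 - lambda - c).
    by apply: ler_wpM2r; lra.
  apply: (@cylinder_mul (c - lambda) (1 - lambda) lambda); try lra.
  - by split; lra.
  - exact: cylinder_digit.
  - exact: cylinder_digit.
have [u [v [-> hu hv]]] : exists u v, [/\ z = u * v, c - lambda ^+ 2 <= u <= c &
    in_children (1 - lambda) lambda v].
  have l20 : 0 <= lambda ^+ 2 by rewrite exprn_ge0 // ltW.
  have l2l : 0 <= lambda * (1 - lambda) by apply: mulr_ge0; lra.
  have cl : 0 <= lambda * c by apply: mulr_ge0; lra.
  (* Split z according to the two intervals [1 - lambda, 1 - lambda + c lambda]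
     and [1 - lambda ^+ 2, 1] formed by the children of f3(I). *)
  have [h|h] := leP z (c * (1 - lambda + c * lambda)).
    have [||||||u [v [-> hu hv]]] :=
      @mul_itv_onto _ (c - lambda ^+ 2) c (1 - lambda)
        (1 - lambda + c * lambda) z; try lra.
      (* (c - lambda^2)(1 - lambda) <= lambda follows from c < 1/2 and
         (1 - lambda)^2 < 1/2: the difference is the sum of the next two
         products. *)
      have : 0 <= (1 / 2 - c) * (1 - lambda) by apply: mulr_ge0; lra.
      have : 0 <= (1 - 2 * (1 - lambda) ^+ 2) * (1 - (1 - lambda) / 2).
        by apply: mulr_ge0; lra.
      lra.
    by exists u, v; split=> //; left.
  have [||||||u [v [-> hu hv]]] :=
    @mul_itv_onto _ (c - lambda ^+ 2) c (1 - lambda + (1 - lambda) * lambda)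
      (1 - lambda + lambda) z; try lra.
    apply: le_trans (ltW h).
    have : 0 <= c * (lambda * (1 - lambda) - (1 - lambda - c)).
      by apply: mulr_ge0; lra.
    nra.
  by exists u, v; split=> //; right.
have [s ds hs] := in_children_digit (ltW lambda_gt0) hv.
have s0 : 0 <= s by move: ds => [->|->|->]; lra.
have s1 : s <= 1 - lambda by move: ds => [->|->|->]; lra.
have ls0 : 0 <= lambda * s by apply: mulr_ge0; lra.
have ls1 : lambda * s <= lambda * (1 - lambda) by apply: ler_wpM2l; lra.
have ll0 : 0 <= lambda * lambda by apply: mulr_ge0; lra.
have ll1 : lambda * lambda <= lambda * 1 by apply: ler_wpM2l; lra.
(* The left endpoint of f2(f3(I)) is written as that of a child of f2(I). *)
apply: (@cylinder_mul (c - lambda + lambda * (1 - lambda))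
  (1 - lambda + lambda * s) (lambda * lambda)); try lra.
- split.
    have : (c - lambda + lambda * (1 - lambda) + lambda * lambda)
           * (1 - lambda - c) <= 1 * (1 - lambda - c).
      by apply: ler_wpM2r; lra.
    lra.
  have : (1 - lambda + lambda * s + lambda * lambda) * (1 - lambda - c)
         <= 1 * (1 - lambda - c).
    by apply: ler_wpM2r; lra.
  lra.
- exact/cylinder_child/d3/cylinder_digit.
- exact/cylinder_child/ds/cylinder_digit.
Qed.

Lemma mul_set_unit z : 0 <= z -> z <= 1 -> mul_set K K z.
Proof.
have [lambda_gt0 c_ge c_lt c_le sq_le_c] := params.
move=> z0 z1; have [->|z_neq0] := eqVneq z 0.
  by exists 0 => //; exists 0 => //; rewrite mulr0.
have zp : 0 < z by rewrite lt_neqAle eq_sym z_neq0.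
have [n /ltW hn] : exists n, lambda ^+ n < z by apply: exists_expr_lt; lra.
elim: n z {z0 z_neq0} zp z1 hn => [|n IHn] z zp z1 hn.
  by apply: mul_set_top => //; rewrite expr0 in hn; lra.
have [hl|hl] := leP lambda z.
  have [zc|zc] := leP z c; first exact: mul_set_middle.
  by apply: mul_set_top => //; lra.
have [x Kx [y Ky e]] : mul_set K K (z / lambda).
  apply: IHn; first exact: divr_gt0.
    by rewrite ler_pdivrMr // mul1r ltW.
  by rewrite ler_pdivlMr // mulrC -exprS.
exists (0 + lambda * x); first by apply: K_digit => //; constructor 1.
exists y => //; rewrite add0r -mulrA e; field.
exact: lt0r_neq0.
Qed.
End covering.

(** * Convex hulls on the line *)

Lemma sub_convex_hull_itv (R : realType) (A J : set R) :
  is_interval J -> A `<=` J -> convex_hull A `<=` J.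
Proof.
move=> iJ; apply: smallest_sub => x y l; rewrite !inE => Jx Jy.
have [xy|yx] := leP x y.
  by apply: (iJ x y) => //; exact: convR_itv.
by apply: (iJ y x) => //; rewrite convC; apply: convR_itv; exact: ltW.
Qed.

(** If 0 or 1 were not in A, a half-open interval would contain the hull. *)
Lemma convex_hull_unit_endpoints (R : realType) (A : set R) :
  convex_hull A = `[0, 1]%classic -> A 0 /\ A 1.
Proof.
move=> hullA.
have A01 : A `<=` `[0, 1]%classic by rewrite -hullA; exact: sub_gen_smallest.
split; apply: contrapT => nA.
  have /(_ 0) : convex_hull A `<=` `]0, 1]%classic.
    apply: sub_convex_hull_itv; first exact: interval_is_interval.
    move=> x Ax; have := A01 _ Ax; rewrite /= !in_itv /= => /andP[x0 ->].
    by rewrite andbT lt_neqAle x0 andbT; apply/eqP => e; apply: nA; rewrite e.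
  by rewrite hullA /= !in_itv /= lexx ler01 ltxx => /(_ isT).
have /(_ 1) : convex_hull A `<=` `[0, 1[%classic.
  apply: sub_convex_hull_itv; first exact: interval_is_interval.
  move=> x Ax; have := A01 _ Ax; rewrite /= !in_itv /= => /andP[-> x1] /=.
  by rewrite lt_neqAle x1 andbT; apply/eqP => e; apply: nA; rewrite -e.
by rewrite hullA /= !in_itv /= lexx ler01 ltxx => /(_ isT).
Qed.

(** * The criterion *)

Theorem theorem1p1 (R : realType) (lambda c : R) (K : set R)
  (lambda_gt0 : 0 < lambda) (lambda_lt1 : lambda < 1)
  (K_attractor : is_attractor (f1 lambda) (f2 lambda c) (f3 lambda) K)
  (K_hull : convex_hull K = `[0, 1]%classic)
  (f12_meet : f1 lambda @` `[0, 1]%classic `&` f2 lambda c @` `[0, 1]%classic !=set0)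
  (f3_disj : (f1 lambda @` `[0, 1]%classic `|` f2 lambda c @` `[0, 1]%classic)
               `&` f3 lambda @` `[0, 1]%classic = set0) :
  mul_set K K = `[0, 1]%classic <-> (1 - lambda) ^+ 2 <= c.
Proof.
have [K0 K1] := convex_hull_unit_endpoints K_hull.
have K01 x : K x -> 0 <= x <= 1.
  move=> Kx.
  have : `[0, 1]%classic x by rewrite -K_hull; exact: sub_gen_smallest.
  by rewrite /= in_itv.
move: K_attractor => [_ K_compact K_eq].
have K_digit s x : digit lambda c s -> K x -> K (s + lambda * x).
  move=> ds Kx; rewrite K_eq; case: ds => ->.
  - by left; left; exists x => //; rewrite /f1 add0r.
  - by left; right; exists x => //; rewrite /f2; ring.
  - by right; exists x => //; rewrite /f3; ring.
have c_ge : lambda <= c.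
  have /K01 : K (c - lambda + lambda * 0).
    by apply: K_digit => //; constructor 2.
  lra.
have c_le1 : c <= 1.
  have /K01 : K (c - lambda + lambda * 1).
    by apply: K_digit => //; constructor 2.
  lra.
have c_le : c <= 2 * lambda.
  move: f12_meet => [_ [[x + <-] [y + e]]].
  rewrite /= !in_itv /= => /andP[x0 x1] /andP[y0 y1].
  have : 0 <= lambda * (1 - x) by apply: mulr_ge0; lra.
  have : 0 <= lambda * y by apply: mulr_ge0; lra.
  by move: e; rewrite /f1 /f2; lra.
have c_lt : c < 1 - lambda.
  (* Otherwise f2 1 = c would lie in f3(I). *)
  rewrite ltNge; apply/negP => hc.
  suff : set0 c by [].
  rewrite -f3_disj; split.
    by right; exists 1; [rewrite /= in_itv /= lexx ler01|rewrite /f2; ring].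
  exists ((c - 1 + lambda) / lambda).
    by rewrite /= in_itv /= ler_pdivlMr // ler_pdivrMr //; lra.
  by rewrite /f3; field; exact: lt0r_neq0.
have K_gap x : K x -> x <= c \/ 1 - lambda <= x.
  rewrite K_eq => -[[|]|] [y /K01/andP[y0 y1] <-].
  - by left; rewrite /f1; nra.
  - by left; rewrite /f2; nra.
  - by right; rewrite /f3; nra.
split=> [KK|sq_le_c].
  rewrite leNgt; apply/negP => c_lt_sq.
  (* z is the midpoint of the interval of missed values. *)
  pose z := (c + (1 - lambda) ^+ 2) / 2.
  have cz : c < z by rewrite /z; lra.
  have zs : z < (1 - lambda) ^+ 2 by rewrite /z; lra.
  have [x Kx [y Ky xyz]] : mul_set K K z.
    rewrite KK /= in_itv /=; apply/andP; split; nra.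
  move: (K01 _ Kx) (K01 _ Ky) => /andP[x0 x1] /andP[y0 y1].
  case: (K_gap _ Kx) => hx; first by nra.
  case: (K_gap _ Ky) => hy; first by nra.
  by nra.
apply/seteqP; split=> z; rewrite /= in_itv /=.
  move=> [x /K01/andP[x0 x1] [y /K01/andP[y0 y1] <-]].
  by rewrite mulr_ge0 // mulr_ile1.
by move=> /andP[z0 z1]; apply: (@mul_set_unit _ lambda c).
Qed.
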